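(* For every integer $n\ge 3$, the polynomial $R_n(q)=\sum_{k=0}^{n-1}r(n,k)q^k$ is not real-rooted, i.e. it has at least one non-real complex zero.
   Context: A rooted labeled tree on $[n]=\{1,\ldots,n\}$ is a tree with vertex set $[n]$ together with a distinguished vertex (the root); it is unordered, i.e. the children of a vertex carry no linear order. Each vertex is identified with its label. An edge of such a tree is written $(i,j)$ with $i$ the parent of $j$. The edge $(i,j)$ is called proper if $i$ is smaller than the label of every vertex in the subtree rooted at $j$ (including $j$ itself); otherwise it is called improper. For $n\ge1$ and $0\le k\le n-1$, $r(n,k)$ denotes the number of rooted labeled trees on $[n]$ with exactly $k$ improper edges. It is a known result of Shor that $r(1,0)=1$ and, for $n\ge 2$ and $0\le k\le n-1$, $r(n,k)=(n-1)r(n-1,k)+(n+k-2)r(n-1,k-1)$, with the convention $r(n,k)=0$ for $k<0$ or $k\ge n$. A real polynomial is real-rooted if all its complex zeros are real. *)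

(* Defs.v *)
From mathcomp Require Import all_boot all_order all_algebra.
From mathcomp Require Import complex reals.

Set Implicit Arguments.
Unset Strict Implicit.
Unset Printing Implicit Defensive.

(* The labels 1, ..., n are represented by 0, ..., n - 1 : 'I_n; properness of
   an edge depends only on the order of the labels. *)

Section RootedLabeledTrees.

Variable n : nat.

(* A graph on 'I_n is given by its set of edges, which are 2-element sets. *)
Implicit Types (E : {set {set 'I_n}}) (r i j v : 'I_n).

Definition simple_graph E : bool := [forall e in E, #|e| == 2].

Definition adj E : rel 'I_n := fun i j => [set i; j] \in E.

Definition connected_graph E : bool :=
  [forall i, forall j, connect (adj E) i j].

(* The bound on the length k is harmless: a duplicate-free cycle has at most n
   vertices. The condition 2 < k excludes going back and forth on an edge. *)
Definition acyclic_graph E : bool :=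
  [forall k : 'I_n.+1, (2 < k) ==>
     [forall c : k.-tuple 'I_n, ~~ (cycle (adj E) c && uniq c)]].

Definition is_tree E : bool :=
  [&& simple_graph E, connected_graph E & acyclic_graph E].

(* j is on the simple path r :: p from r to v; in a tree there is exactly one
   such path. *)
Definition on_path E r v j : bool :=
  [exists k : 'I_n, exists p : k.-tuple 'I_n,
     [&& path (adj E) r p, uniq (r :: p), last r p == v & j \in r :: p]].

(* (E, r) stands for the tree with edge set E and root r. *)
Definition parent E r i j : bool := adj E i j && on_path E r j i.

Definition subtree E r j : {set 'I_n} := [set v | on_path E r v j].

Definition proper_edge E r i j : bool := [forall v in subtree E r j, i < v].

Definition improper_edges E r : {set 'I_n * 'I_n} :=
  [set ij | parent E r ij.1 ij.2 && ~~ proper_edge E r ij.1 ij.2].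

End RootedLabeledTrees.

(* The number r(n, k) of rooted labeled trees with exactly k improper edges. *)
Definition nb_trees (n k : nat) : nat :=
  #|[set T : {set {set 'I_n}} * 'I_n |
       is_tree T.1 & #|improper_edges T.1 T.2| == k]|.

Import GRing.Theory.
Local Open Scope ring_scope.

Definition R_poly (R : realType) (n : nat) : {poly R} :=
  \poly_(k < n) (nb_trees n k)%:R.

Definition real_rooted (R : realType) (p : {poly R}) : Prop :=
  forall z : complex R,
    root (map_poly (real_complex R) p) z -> complex.Im z = 0.

(* Main.v *)
Require Import Defs.
From mathcomp Require Import all_boot all_order all_algebra.
From mathcomp Require Import complex reals.
From mathcomp Require Import ring.

(** Only the three lowest coefficients of [R_n] matter.  Put [d = n - 1]; they
    satisfy [r(n,0) = d!], [r(n,1) = d * d!] and, for [n >= 3],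
    [r(n,2) > 'C(d, 2) * d!].  If [R_n] had only real zeros [z_1, ..., z_m]
    ([m <= d]; none of them is [0]), then [x_i = 1 / z_i] would be real with
    [\sum x_i = - d] and
    [\sum x_i^2 = d^2 - 2 r(n,2) / r(n,0) < d^2 - d (d - 1) = d], whence
    [\sum (x_i + 1)^2 < d - 2 d + m <= 0], a contradiction
    ([nonreal_root]).

    The coefficients come from a part of Shor's recurrence that has a simple
    bijective proof ([card_rooted_maps]).  Remove the largest label.  The
    edges to its children are improper, so in a tree with [k] improper edges
    it has at most [k] children.  If it is a leaf, removing it keeps all
    improper edges, and it could have been attached to any vertex
    ([card_slice0]).  If it has one child, contracting it loses exactly one improper edge, and it could have
    been inserted above any vertex ([card_slice1]).  This determines [r(n,0)]
    and [r(n,1)], and bounds [r(n,2)] from below; the bound becomes strict at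
    [n = 3], because of the tree whose root [3] has the children [1] and [2].

    To carry this out, a tree [(E, r)] is replaced by the pair [(f, r)], where
    [f] sends each vertex to its parent and fixes [r]; then [v] lies in the
    subtree of [j] exactly when some iterate of [f] sends [v] to [j]
    ([on_path_edges], [nb_treesE]). *)

Set Implicit Arguments.
Unset Strict Implicit.
Unset Printing Implicit Defensive.

(** * Trees as parent maps *)

Definition parent_map (n : nat) (f : 'I_n -> 'I_n) (r : 'I_n) : bool :=
  (f r == r) && [forall v, fconnect f v r].

Definition edges (n : nat) (f : 'I_n -> 'I_n) : {set {set 'I_n}} :=
  [set [set v; f v] | v in [pred v | f v != v]].

(** An edge of a tree is encoded by its lower end, so that a set of vertices
    stands for the set of improper edges. *)
Definition improper (n : nat) (f : 'I_n -> 'I_n) : {set 'I_n} :=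
  [set v | (f v != v) && [exists u, fconnect f u v && (u <= f v)]].

Definition rooted_maps (n k : nat) : {set {ffun 'I_n -> 'I_n} * 'I_n} :=
  [set T : {ffun 'I_n -> 'I_n} * 'I_n |
     parent_map T.1 T.2 & #|improper T.1| == k].

Section ParentMap.

Variables (n : nat) (f : 'I_n -> 'I_n) (r : 'I_n).
Hypothesis pm : parent_map f r.

Let depth v := findex f v r.

Lemma pm_root : f r = r.
Proof. by case/andP: pm => /eqP. Qed.

Lemma pm_conn v : fconnect f v r.
Proof. by case/andP: pm => _ /forallP. Qed.

Lemma pm_fixed v : (f v == v) = (v == r).
Proof.
apply/eqP/eqP => [fv|->]; last exact: pm_root.
by rewrite -(iter_findex (pm_conn v)); elim: findex => //= k <-.
Qed.

Lemma depth_parent v : v != r -> depth v = (depth (f v)).+1.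
Proof. by move=> vr; rewrite /depth fconnect_findex ?pm_conn // eq_sym. Qed.

Lemma depth_ancestor u v : fconnect f u v -> depth v <= depth u.
Proof.
move/iter_findex <-; elim: findex => //= k IH; apply: leq_trans IH.
have [->|xr] := eqVneq (iter k f u) r; first by rewrite pm_root.
by rewrite (depth_parent xr).
Qed.

Lemma adj_edges i j :
  adj (edges f) i j = (i != j) && ((f i == j) || (f j == i)).
Proof.
rewrite /adj; apply/imsetP/idP => [[v]|/andP[ij /orP[]/eqP fE]].
- rewrite inE => fv E.
  have nij : i != j.
    apply: contraNneq fv => ij; move: E; rewrite ij setUid => E.
    have /set1P vj : v \in [set j] by rewrite E set21.
    have /set1P fvj : f v \in [set j] by rewrite E set22.
    by rewrite fvj vj.
  rewrite nij /=.
  have /set2P Hi : i \in [set v; f v] by rewrite -E set21.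
  have /set2P Hj : j \in [set v; f v] by rewrite -E set22.
  by case: Hi Hj nij => -> [] ->; rewrite eqxx ?orbT.
- by exists i; rewrite ?inE fE // eq_sym.
- by exists j; rewrite ?inE fE // setUC.
Qed.

Lemma adj_sym (E : {set {set 'I_n}}) : symmetric (adj E).
Proof. by move=> i j; rewrite /adj setUC. Qed.

Let down : rel 'I_n := fun x y => (f y == x) && (y != x).

(** A simple path can never turn from going down to going up: going up means
    going back to the parent, which has just been visited. *)
Lemma uniq_path_down x p :
  path (adj (edges f)) x p -> uniq (x :: p) -> f x \notin p -> path down x p.
Proof.
elim: p x => //= y p IH x /andP[]; rewrite adj_edges => /andP[xy fxy] Hp.
rewrite !inE !negb_or => /andP[/andP[_ xp] yp] /andP[fx _].
move: fxy; rewrite (negPf fx) /= => /eqP fy.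
by rewrite /down fy eqxx eq_sym xy /= IH // fy.
Qed.

Lemma down_path_ex v : exists2 p, path down r p & last r p = v.
Proof.
have [m] := ubnP (depth v); elim: m v => // m IH v.
have [->|vr] := eqVneq v r; first by exists [::].
rewrite (depth_parent vr) ltnS => /IH[p pp lp]; exists (rcons p v).
  by rewrite rcons_path pp lp /down eqxx eq_sym pm_fixed.
by rewrite last_rcons.
Qed.

Lemma down_path_uniq x p : path down x p -> uniq (x :: p).
Proof.
move=> pp; apply: (@map_uniq _ _ depth).
apply: (sorted_uniq ltn_trans ltnn); rewrite /= path_map.
apply: sub_path pp => a b /andP[/eqP fb ba] /=.
by rewrite (@depth_parent b) ?fb // -pm_fixed fb eq_sym.
Qed.

Lemma down_path_ancestor x p v :
  path down x p -> v \in x :: p -> fconnect f (last x p) v.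
Proof.
elim: p x v => [|y p IH] x v /=; first by rewrite inE => _ /eqP ->.
case/andP=> /andP[/eqP fy _] pp; rewrite inE => /predU1P[->|]; last exact: IH.
apply: (connect_trans (IH y y pp (mem_head _ _))).
by rewrite -fy fconnect1.
Qed.

(** The vertices of a path that descends from the root are closed under [f]. *)
Lemma ancestor_down_path p j :
  path down r p -> fconnect f (last r p) j -> j \in r :: p.
Proof.
move=> pp /iter_findex <-; elim: findex => [|k]; first exact: mem_last.
rewrite iterS; move: (iter _ _ _) => y.
suff H x q : path down x q -> y \in q -> f y \in x :: q.
  by rewrite inE => /predU1P[->|/(H r p pp)//]; rewrite pm_root mem_head.
elim: q x => //= z q IH x /andP[/andP[/eqP fz _] qq].
rewrite inE => /predU1P[->|/IH]; first by rewrite fz mem_head.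
by move/(_ z qq) => H; rewrite inE H orbT.
Qed.

(** The simple paths from the root are the descending ones, and these run
    through exactly the ancestors of their end. *)
Lemma on_path_edges v j : on_path (edges f) r v j = fconnect f v j.
Proof.
apply/existsP/idP => [[k /existsP[p /and4P[pp up /eqP <- jp]]]|vj].
  apply: down_path_ancestor jp; apply: uniq_path_down => //.
  by rewrite pm_root; case/andP: up.
have [p pp lp] := down_path_ex v; have up := down_path_uniq pp.
have sp : size p < n.
  by move/card_uniqP: up => /= <-; rewrite -[X in _ <= X]card_ord max_card.
exists (Ordinal sp); apply/existsP; exists (in_tuple p).
rewrite up lp eqxx /= ancestor_down_path ?lp // andbT.
apply: sub_path pp => a b /andP[fb ba].
by rewrite adj_edges fb orbT eq_sym ba.
Qed.

Lemma parent_edges i j :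
  parent (edges f) r i j = (f j == i) && (j != i).
Proof.
rewrite /parent adj_edges on_path_edges [i == j]eq_sym andbC andbCA [RHS]andbC.
case: eqVneq => //= ji.
have [fj|fj] := eqVneq (f j) i; first by rewrite -fj fconnect1 orbT.
apply/negP => /andP[/depth_ancestor d]; rewrite orbF => /eqP fi.
have ir : i != r by rewrite -pm_fixed fi.
by move: d; rewrite (depth_parent ir) fi ltnn.
Qed.

Lemma improper_edgesE :
  improper_edges (edges f) r = [set (f v, v) | v in improper f].
Proof.
apply/setP => -[i j]; rewrite inE /= parent_edges /proper_edge.
apply/andP/imsetP => [[/andP[/eqP fj ji] /forall_inPn[u]]|[v + [-> ->]]].
  rewrite inE on_path_edges -leqNgt => uj ui; exists j; last by rewrite fj.
  by rewrite inE fj eq_sym ji; apply/existsP; exists u; rewrite uj.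
rewrite inE eqxx [v == _]eq_sym => /andP[-> /existsP[u /andP[uv ufv]]].
split=> //; apply/forall_inPn; exists u; rewrite -?leqNgt //.
by rewrite inE on_path_edges.
Qed.

Lemma card_improper_edges : #|improper_edges (edges f) r| = #|improper f|.
Proof. by rewrite improper_edgesE card_imset // => u v []. Qed.

Lemma connect_edges i j : connect (adj (edges f)) i j.
Proof.
have H v : connect (adj (edges f)) v r.
  rewrite -(iter_findex (pm_conn v)); elim: findex => //= k IH.
  apply: connect_trans IH _; move: (iter _ _ _) => w.
  have [->|fw] := eqVneq (f w) w; first exact: connect0.
  by apply: connect1; rewrite adj_edges eqxx eq_sym fw.
by apply: connect_trans (H i) _; rewrite (sym_connect_sym (@adj_sym _)).
Qed.

(** Both neighbours of a deepest vertex on a cycle would be its parent. *)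
Lemma edges_acyclic : acyclic_graph (edges f).
Proof.
apply/forallP => k; apply/implyP => k2; apply/forallP => c.
apply/negP => /andP[cc uc]; have sc := size_tuple c.
move: (tval c) cc uc sc => {}c cc uc sc.
have [v0 v0c] : exists v, v \in c.
  case: c sc {cc uc} => [k0|v c _]; first by rewrite -k0 in k2.
  by exists v; rewrite mem_head.
case: (@arg_maxnP _ v0 [in c] depth v0c) => v vc vmax.
have [i c' ec] := rot_to vc.
move: cc uc; rewrite -(rot_cycle i) -(rot_uniq i) ec.
have memc x : x \in v :: c' -> depth x <= depth v.
  by rewrite -ec mem_rot => /vmax.
have : 1 < size c' by rewrite -sc -(size_rot i) ec in k2.
case: c' memc {ec} => // a c'; case/lastP: c' => // c' b memc _.
rewrite /= rcons_path last_rcons => /and3P[va _ bv].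
rewrite !(inE, mem_rcons) => /and3P[_ /norP[ab _] _].
have parentP x : x \in v :: a :: rcons c' b -> adj (edges f) v x -> f v = x.
  move=> /memc dx; rewrite adj_edges => /andP[vx /orP[]/eqP// fx].
  have xr : x != r by rewrite -pm_fixed fx.
  by move: dx; rewrite (depth_parent xr) fx ltnn.
case/eqP: ab; rewrite -(parentP a) ?inE ?eqxx ?orbT //.
by apply: parentP; rewrite 1?adj_sym // !inE mem_rcons mem_head !orbT.
Qed.

Lemma edges_tree : is_tree (edges f).
Proof.
apply/and3P; split; last exact: edges_acyclic.
- apply/forall_inP => e /imsetP[v]; rewrite inE => fv ->.
  by rewrite cards2 [v == _]eq_sym fv.
- by apply/forallP => i; apply/forallP => j; apply: connect_edges.
Qed.

End ParentMap.

(** The parent relation of a tree is defined from its edge set and its root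
    alone. *)
Lemma edges_inj n (f g : 'I_n -> 'I_n) r :
  parent_map f r -> parent_map g r -> edges f = edges g -> f =1 g.
Proof.
move=> pf pg E v; have [->|vr] := eqVneq v r.
  by rewrite (pm_root pf) (pm_root pg).
have : parent (edges f) r (f v) v.
  by rewrite (parent_edges pf) eqxx eq_sym (pm_fixed pf).
by rewrite E (parent_edges pg) => /andP[/eqP].
Qed.

Section TreeParent.

Variables (n : nat) (E : {set {set 'I_n}}) (r : 'I_n).
Hypothesis treeE : is_tree E.

(** The length of a shortest path to the root. *)
Lemma tree_distance : exists2 d : 'I_n -> nat, d r = 0 &
  forall v, v != r -> exists2 y, adj E v y & d y < d v.
Proof.
pose P v k := [exists p : k.-tuple 'I_n, path (adj E) v p && (last v p == r)].
have exP v : exists k, P v k.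
  case/and3P: treeE => _ /forallP/(_ v)/forallP/(_ r)/connectP[p pp lp] _.
  by exists (size p); apply/existsP; exists (in_tuple p); rewrite pp -lp eqxx.
exists (fun v => ex_minn (exP v)) => [|v vr].
  case: ex_minnP => m _ /(_ 0); rewrite leqn0 => H; apply/eqP; apply: H.
  by apply/existsP; exists [tuple]; rewrite /= eqxx.
case: (ex_minnP (exP v)) => m /existsP[p /andP[pp /eqP lp]] _.
have := size_tuple p; move: (tval p) pp lp => {p} [|y p] /=.
  by move=> _ /eqP; rewrite (negPf vr).
case/andP=> vy pp lp <-; exists y => //.
case: ex_minnP => k _ H; rewrite ltnS; apply: H.
by apply/existsP; exists (in_tuple p); rewrite pp /= lp eqxx.
Qed.

(** Each vertex is sent to a neighbour closer to the root.  An edge of [E]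
    missing from the edges of this map would close a cycle in [E], together
    with the path that joins its ends through those edges. *)
Lemma tree_parent_map : exists2 f : {ffun 'I_n -> 'I_n},
  parent_map f r & edges f = E.
Proof.
have [d dr dP] := tree_distance.
pose f := [ffun v => odflt v [pick y | adj E v y && (d y < d v)]].
have fP v : v != r -> adj E v (f v) && (d (f v) < d v).
  move=> vr; rewrite ffunE; case: pickP => //= H.
  by have [y ay dy] := dP v vr; move: (H y); rewrite /= ay dy.
have fr : f r = r.
  by rewrite ffunE; case: pickP => // y; rewrite dr ltn0 andbF.
have pf : parent_map f r.
  rewrite /parent_map fr eqxx /=; apply/forallP => v.
  have [m] := ubnP (d v); elim: m v => // m IH v dv.
  have [->|vr] := eqVneq v r; first exact: connect0.
  apply: connect_trans (fconnect1 f v) (IH _ _).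
  by case/andP: (fP v vr) => _ H; apply: leq_trans H _.
have subE : edges f \subset E.
  apply/subsetP => e /imsetP[v]; rewrite inE (pm_fixed pf) => /fP/andP[+ _] ->.
  by [].
exists f => //; apply/eqP; rewrite eqEsubset subE /=; apply/subsetP => e eE.
case/and3P: treeE => /forall_inP/(_ e eE)/cards2P + _ acE.
case=> u [w [uw eq_e]]; move: eE; rewrite {}eq_e => uwE; apply/negPn/negP => uwf.
case/connectP: (connect_edges pf u w) => p0 /shortenP[p pp up _] lp.
have : 1 < size p.
  case: p pp lp {up} => [_ /= wu|y [|//]]; first by rewrite wu eqxx in uw.
  by rewrite /= andbT /adj => + wy; rewrite -wy (negPf uwf).
have sp : size (u :: p) < n.+1.
  by move/card_uniqP: up => <-; rewrite ltnS -[X in _ <= X]card_ord max_card.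
move=> p1; have/forallP := implyP (forallP acE (Ordinal sp)) p1.
move/(_ (in_tuple (u :: p)))/negP; apply; rewrite up andbT.
rewrite [cycle _ _]rcons_path -lp adj_sym /adj uwE andbT.
by apply: sub_path pp => a b; apply: (subsetP subE).
Qed.

End TreeParent.

Lemma nb_treesE n k : nb_trees n k = #|rooted_maps n k|.
Proof.
pose G (T : {ffun 'I_n -> 'I_n} * 'I_n) := (edges T.1, T.2).
rewrite /nb_trees /rooted_maps -(@card_in_imset _ _ G) => [|[f r] [g s]].
  apply: eq_card => -[E r]; rewrite inE /=; apply/andP/imsetP => [[tE kE]|].
    have [f pf eE] := tree_parent_map r tE; exists (f, r); last by rewrite /G eE.
    by rewrite inE pf -(card_improper_edges pf) eE.
  case=> -[f s]; rewrite inE /= => /andP[pf kf] [-> ->].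
  by rewrite (edges_tree pf) (card_improper_edges pf).
rewrite !inE /= => /andP[pf _] /andP[pg _] [E rs]; rewrite -{}rs in pg *.
by congr pair; apply/ffunP; apply: edges_inj pf pg E.
Qed.

(** * Removing the largest label *)

Definition children_max (n : nat) (g : 'I_n.+1 -> 'I_n.+1) : {set 'I_n.+1} :=
  [set x | (g x == ord_max) && (x != ord_max)].

(** The largest label becomes a leaf attached to [v]; [lift ord_max] embeds the
    old labels. *)
Definition add_leaf (n : nat) (T : {ffun 'I_n -> 'I_n} * 'I_n * 'I_n) :
    {ffun 'I_n.+1 -> 'I_n.+1} * 'I_n.+1 :=
  let: (f, r, v) := T in
  ([ffun x => lift ord_max (oapp f v (unlift ord_max x))], lift ord_max r).

(** The vertex which hangs from the old parent of [y] once the largest label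
    has been inserted between [v] and its parent: the upper end of the edge
    above [v] is unchanged, but its lower end is the new vertex. *)
Definition raise (n : nat) (v y : 'I_n) : 'I_n.+1 :=
  if y == v then ord_max else lift ord_max y.

(** The largest label is inserted above [v].  If [v] is the root, then
    [raise v (f v)] is [ord_max], so that the largest label becomes the root. *)
Definition add_above (n : nat) (T : {ffun 'I_n -> 'I_n} * 'I_n * 'I_n) :
    {ffun 'I_n.+1 -> 'I_n.+1} * 'I_n.+1 :=
  let: (f, r, v) := T in
  ([ffun x => if unlift ord_max x is Some y then
                if y == v then ord_max else lift ord_max (f y)
              else raise v (f v)], raise v r).

Lemma raise_inj n (v : 'I_n) : injective (raise v).
Proof.
move=> x y; rewrite /raise; case: eqVneq => [->|xv]; case: eqVneq => // yv.
- by move/eqP; rewrite (negPf (neq_lift _ _)).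
- by move/esym/eqP; rewrite (negPf (neq_lift _ _)).
- exact: lift_inj.
Qed.

Lemma lift_neq_max n (y : 'I_n) : (lift ord_max y == ord_max) = false.
Proof. by rewrite eq_sym; apply/negbTE/neq_lift. Qed.

Lemma max_leq_lift n (y : 'I_n) : ((ord_max : 'I_n.+1) <= lift ord_max y) = false.
Proof. by rewrite lift_max leqNgt ltn_ord. Qed.

(** This bounds the number of children of the largest label by the number of
    improper edges. *)
Lemma children_improper n (g : 'I_n.+1 -> 'I_n.+1) :
  children_max g \subset improper g.
Proof.
apply/subsetP => x; rewrite !inE => /andP[/eqP-> xm]; rewrite eq_sym xm /=.
by apply/existsP; exists x; rewrite connect0 -ltnS ltn_ord.
Qed.

(** Both ways of adding the largest label carry the edge above [y] to the edge
    above some [h y], with the same upper end; the lower subtree gains at most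
    the largest label, which never makes an edge below an old label
    improper. *)
Lemma improper_image n (f : 'I_n -> 'I_n) (g : 'I_n.+1 -> 'I_n.+1)
    (h : 'I_n -> 'I_n.+1) :
    (forall y, f y = y -> g (h y) = h y) ->
    (forall y, f y != y -> g (h y) = lift ord_max (f y) /\ g (h y) != h y) ->
    (forall u y, fconnect g (lift ord_max u) (h y) = fconnect f u y) ->
  forall y, (h y \in improper g) = (y \in improper f).
Proof.
move=> fix_h move_h conn_h y; rewrite !inE.
have [fy|fy] := eqVneq (f y) y; first by rewrite fix_h // eqxx.
have [-> _] := move_h y fy; have [<- ->] /= := move_h y fy.
rewrite (proj1 (move_h y fy)).
apply/existsP/existsP => [[u /andP[]]|[u /andP[uy ufy]]].
  case: (unliftP ord_max u) => [u' ->|->]; last by rewrite max_leq_lift.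
  by rewrite conn_h !lift_max => u'y u'f; exists u'; rewrite u'y.
by exists (lift ord_max u); rewrite conn_h uy !lift_max.
Qed.

Section AddLeaf.

Variables (n : nat) (f : {ffun 'I_n -> 'I_n}) (r v : 'I_n).
Let g := (add_leaf (f, r, v)).1.

Lemma add_leaf_lift y : g (lift ord_max y) = lift ord_max (f y).
Proof. by rewrite ffunE liftK. Qed.

Lemma add_leaf_max : g ord_max = lift ord_max v.
Proof. by rewrite ffunE unlift_none. Qed.

Lemma add_leaf_iter k y :
  iter k g (lift ord_max y) = lift ord_max (iter k f y).
Proof. by elim: k => //= k ->; rewrite add_leaf_lift. Qed.

Lemma add_leaf_connect u y :
  fconnect g (lift ord_max u) (lift ord_max y) = fconnect f u y.
Proof.
apply/idP/idP => /iter_findex; last first.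
  by move<-; rewrite -add_leaf_iter fconnect_iter.
by rewrite add_leaf_iter => /lift_inj <-; apply: fconnect_iter.
Qed.

Lemma add_leaf_parent_map : parent_map g (lift ord_max r) = parent_map f r.
Proof.
rewrite /parent_map add_leaf_lift (inj_eq lift_inj); congr (_ && _).
apply/forallP/forallP => H x; first by rewrite -add_leaf_connect.
have Hl y : fconnect g (lift ord_max y) (lift ord_max r).
  by rewrite add_leaf_connect.
case: (unliftP ord_max x) => [y ->|->] //.
by apply: connect_trans (fconnect1 _ _) _; rewrite add_leaf_max.
Qed.

Lemma add_leaf_improper : improper g = lift ord_max @: improper f.
Proof.
apply/setP => x; case: (unliftP ord_max x) => [y ->|->].
  rewrite (mem_imset _ _ lift_inj); apply: improper_image add_leaf_connect _.
    by move=> z fz; rewrite add_leaf_lift fz.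
  by move=> z fz; rewrite add_leaf_lift (inj_eq lift_inj).
transitivity false; last first.
  by apply/esym/imsetP => -[y _ /eqP]; rewrite eq_sym lift_neq_max.
rewrite inE add_leaf_max; apply/andP => -[_ /existsP[u /andP[]]].
case: (unliftP ord_max u) => [y ->|->]; last by rewrite max_leq_lift.
move/iter_findex/eqP.
by rewrite add_leaf_iter lift_neq_max.
Qed.

Lemma add_leaf_children : children_max g = set0.
Proof.
apply/setP => x; rewrite !inE; case: (unliftP ord_max x) => [y ->|->].
  by rewrite add_leaf_lift lift_neq_max.
by rewrite eqxx andbF.
Qed.

End AddLeaf.

Lemma add_leaf_inj n : injective (@add_leaf n).
Proof.
move=> [[f r] v] [[f' r'] v'] E; have /lift_inj rr := congr1 snd E.
have gE := congr1 fst E; congr (_, _, _) => //.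
  apply/ffunP => y; apply: (@lift_inj _ ord_max).
  by rewrite -(add_leaf_lift f r v) gE add_leaf_lift.
by apply: (@lift_inj _ ord_max); rewrite -(add_leaf_max f r v) gE add_leaf_max.
Qed.

Lemma add_leaf_surj n (g : {ffun 'I_n.+1 -> 'I_n.+1}) s : 0 < n ->
  parent_map g s -> children_max g = set0 -> exists T, add_leaf T = (g, s).
Proof.
move=> n0 pg c0; pose y0 := Ordinal n0.
have gl y : g (lift ord_max y) != ord_max.
  apply: contraFN (in_set0 (lift ord_max y)) => gy.
  by rewrite -c0 inE gy lift_neq_max.
(* A childless root would be the only vertex, but [n] is positive. *)
have gm : g ord_max != ord_max.
  rewrite (pm_fixed pg) eq_sym; apply/eqP => sm.
  suff H k : iter k g (lift ord_max y0) != ord_max.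
    have := H (findex g (lift ord_max y0) s).
    by rewrite iter_findex ?pm_conn // sm eqxx.
  elim: k => [|k]; first by rewrite lift_neq_max.
  rewrite iterS; move: (iter k _ _) => x.
  by case: (unliftP ord_max x) => [y ->|->] //; rewrite eqxx.
have sm : s != ord_max by apply: contraNneq gm => <-; rewrite (pm_root pg).
exists ([ffun y => odflt y (unlift ord_max (g (lift ord_max y)))],
  odflt y0 (unlift ord_max s), odflt y0 (unlift ord_max (g ord_max))).
have liftO y z : z != ord_max ->
    lift ord_max (odflt y (unlift ord_max z)) = z :> 'I_n.+1.
  by case: (unliftP ord_max z) => [? -> //|->]; rewrite eqxx.
congr (_, _); last exact: liftO.
apply/ffunP => x; rewrite ffunE.
case: (unliftP ord_max x) => [y ->|->] /=; last exact: liftO.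
by rewrite ffunE liftO.
Qed.

Section AddAbove.

Variables (n : nat) (f : {ffun 'I_n -> 'I_n}) (r v : 'I_n).
Let g := (add_above (f, r, v)).1.

Lemma add_above_lift y :
  g (lift ord_max y) = if y == v then ord_max else lift ord_max (f y).
Proof. by rewrite ffunE liftK. Qed.

Lemma add_above_max : g ord_max = raise v (f v).
Proof. by rewrite ffunE unlift_none. Qed.

Let contract (x : 'I_n.+1) : 'I_n := odflt v (unlift ord_max x).

Lemma contract_lift y : contract (lift ord_max y) = y.
Proof. by rewrite /contract liftK. Qed.

Lemma contract_raise y : contract (raise v y) = y.
Proof.
rewrite /raise; case: eqVneq => [->|_]; last exact: contract_lift.
by rewrite /contract unlift_none.
Qed.

(** A step of [g] becomes, after contraction, a step of [f] or no step. *)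
Lemma contract_connect a b :
  fconnect g a b -> fconnect f (contract a) (contract b).
Proof.
move/iter_findex <-; elim: findex => //= k IH; apply: connect_trans IH _.
move: (iter _ _ _) => {a b} x; case: (unliftP ord_max x) => [y ->|->].
  rewrite add_above_lift contract_lift; case: eqVneq => [->|yv].
    by rewrite /contract unlift_none.
  by rewrite contract_lift fconnect1.
by rewrite add_above_max contract_raise /contract unlift_none fconnect1.
Qed.

Lemma add_above_connect u y :
  fconnect g (lift ord_max u) (raise v y) = fconnect f u y.
Proof.
apply/idP/idP => [/contract_connect|].
  by rewrite contract_lift contract_raise.
have conn_lift x : fconnect f u x -> fconnect g (lift ord_max u) (lift ord_max x).
  move/iter_findex <-; elim: findex => //= k IH; apply: connect_trans IH _.
  move: (iter _ _ _) => {}x.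
  have [->|fx] := eqVneq (f x) x; first exact: connect0.
  have := fconnect1 g (lift ord_max x); rewrite add_above_lift.
  case: eqVneq => // xv; rewrite {x}xv in fx *; move/connect_trans; apply.
  by have := fconnect1 g ord_max; rewrite add_above_max /raise (negPf fx).
move=> uy; rewrite /raise; case: eqVneq => [yv|_]; last exact: conn_lift.
apply: connect_trans (conn_lift _ uy) _.
by have := fconnect1 g (lift ord_max y); rewrite add_above_lift yv eqxx.
Qed.

Lemma add_above_fixed y : f y = y -> g (raise v y) = raise v y.
Proof.
move=> fy; rewrite {1}/raise; case: eqVneq => [yv|yv].
  by rewrite add_above_max -yv fy.
by rewrite add_above_lift (negPf yv) fy /raise (negPf yv).
Qed.

Lemma add_above_move y : f y != y ->
  g (raise v y) = lift ord_max (f y) /\ g (raise v y) != raise v y.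
Proof.
move=> fy; have gE : g (raise v y) = lift ord_max (f y).
  rewrite /raise; case: eqVneq => [yv|yv]; last first.
    by rewrite add_above_lift (negPf yv).
  by rewrite add_above_max -yv /raise (negPf fy).
rewrite gE; split=> //; rewrite /raise; case: ifP => _.
  by rewrite lift_neq_max.
by rewrite (inj_eq lift_inj).
Qed.

Lemma add_above_parent_map : parent_map g (raise v r) = parent_map f r.
Proof.
apply/andP/andP => -[/eqP rr /forallP conn].
  split; last by apply/forallP => u; rewrite -add_above_connect.
  by apply/negPn/negP => /add_above_move[_]; rewrite rr eqxx.
split; first by rewrite add_above_fixed.
apply/forallP => x; have Hl y : fconnect g (lift ord_max y) (raise v r).
  by rewrite add_above_connect.
case: (unliftP ord_max x) => [y ->|->] //.
have := fconnect1 g ord_max; rewrite add_above_max {1}/raise.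
case: eqVneq => [fv _|_ /connect_trans]; last by apply.
suff -> : r = v by rewrite /raise eqxx connect0.
apply/esym/eqP; rewrite -(@pm_fixed _ f) ?fv //.
by rewrite /parent_map rr eqxx; apply/forallP.
Qed.

(** The edge between the new vertex and its child [v] is always improper, and
    [raise v] carries the old improper edges to the other new ones. *)
Lemma add_above_improper :
  improper g = lift ord_max v |: (raise v @: improper f).
Proof.
apply/setP => x; rewrite in_setU1.
have rE y : (raise v y \in improper g) = (raise v y \in raise v @: improper f).
  rewrite (mem_imset _ _ (@raise_inj _ v)).
  apply: improper_image add_above_connect _; first exact: add_above_fixed.
  exact: add_above_move.
have [->|xv] /= := eqVneq x (lift ord_max v).
  rewrite inE add_above_lift eqxx eq_sym lift_neq_max /=.
  by apply/existsP; exists (lift ord_max v); rewrite connect0 -ltnS ltn_ord.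
suff [y ->] : exists y, x = raise v y by [].
case: (unliftP ord_max x) xv => [y ->|-> _]; last first.
  by exists v; rewrite /raise eqxx.
by rewrite (inj_eq lift_inj) => yv; exists y; rewrite /raise (negPf yv).
Qed.

Lemma card_add_above_improper : #|improper g| = #|improper f|.+1.
Proof.
rewrite add_above_improper cardsU1 (card_imset _ (@raise_inj _ v)).
case: imsetP => [[y _]|//]; rewrite /raise; case: eqVneq => [_ /eqP|yv].
  by rewrite lift_neq_max.
by move/lift_inj => vy; rewrite vy eqxx in yv.
Qed.

Lemma add_above_children : children_max g = [set lift ord_max v].
Proof.
apply/setP => x; rewrite !inE; case: (unliftP ord_max x) => [y ->|->].
  rewrite add_above_lift lift_neq_max andbT (inj_eq lift_inj).
  by case: (eqVneq y v) => _; rewrite ?eqxx ?lift_neq_max.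
by rewrite eqxx andbF eq_sym lift_neq_max.
Qed.

End AddAbove.

Lemma add_above_inj n : injective (@add_above n).
Proof.
move=> [[f r] v] [[f' r'] v'] E; have gE := congr1 fst E.
have /set1_inj/lift_inj vv : [set lift ord_max v] = [set lift ord_max v'].
  by rewrite -(add_above_children f r v) gE add_above_children.
move: E gE; rewrite -{v'}vv => E gE.
have /raise_inj rr := congr1 snd E; congr (_, _, _) => //.
apply/ffunP => y; have [->|yv] := eqVneq y v.
  apply: (@raise_inj _ v).
  by rewrite -(add_above_max f r v) gE add_above_max.
apply: (@lift_inj _ ord_max).
have := add_above_lift f r v y; rewrite gE add_above_lift.
by rewrite (negPf yv).
Qed.

Lemma add_above_surj n (g : {ffun 'I_n.+1 -> 'I_n.+1}) s :
    parent_map g s -> #|children_max g| = 1 ->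
  exists T, add_above T = (g, s).
Proof.
move=> pg /eqP/cards1P[c cE].
have : c \in children_max g by rewrite cE set11.
rewrite inE; case: (unliftP ord_max c) => [v cv|->]; last by rewrite eqxx andbF.
rewrite {c}cv in cE * => /andP[/eqP gv _].
have gl y : y != v -> g (lift ord_max y) != ord_max.
  move=> yv; apply: contraNneq yv => gy.
  by rewrite -(inj_eq (@lift_inj _ ord_max)) -in_set1 -cE inE gy eqxx lift_neq_max.
have vs : lift ord_max v != s by rewrite -(pm_fixed pg) gv eq_sym lift_neq_max.
(* Otherwise the largest label and [v] would be each other's parent. *)
have gm : g ord_max != lift ord_max v.
  apply/eqP => gm; have ms : ord_max != s.
    by rewrite -(pm_fixed pg) gm lift_neq_max.
  have := depth_parent pg ms; rewrite gm (depth_parent pg vs) gv.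
  by move/eqP; rewrite -addn2 -{1}[findex _ _ _]addn0 eqn_add2l.
have raiseO z : z != lift ord_max v ->
    raise v (odflt v (unlift ord_max z)) = z.
  case: (unliftP ord_max z) => [y ->|-> _]; last by rewrite /raise eqxx.
  by rewrite (inj_eq lift_inj) /raise => /negPf->.
exists ([ffun y => if y == v then odflt v (unlift ord_max (g ord_max))
                   else odflt y (unlift ord_max (g (lift ord_max y)))],
  odflt v (unlift ord_max s), v).
congr (_, _); last by apply: raiseO; rewrite eq_sym.
apply/ffunP => x; rewrite ffunE.
case: (unliftP ord_max x) => [y ->|->]; last by rewrite ffunE eqxx raiseO.
case: eqVneq => [->|yv] //; rewrite ffunE (negPf yv).
by have := gl y yv; case: (unliftP ord_max (g _)) => [? -> //|->]; rewrite eqxx.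
Qed.

(** * The lowest coefficients *)

Definition slice (n j k : nat) : {set {ffun 'I_n.+1 -> 'I_n.+1} * 'I_n.+1} :=
  [set T in rooted_maps n.+1 k | #|children_max T.1| == j].

Lemma card_slices n k : #|rooted_maps n.+1 k| = \sum_(j < k.+1) #|slice n j k|.
Proof.
rewrite -sum1_card.
rewrite (partition_big (fun T : {ffun 'I_n.+1 -> 'I_n.+1} * 'I_n.+1 =>
  inord #|children_max T.1| : 'I_k.+1) predT) //=.
apply: eq_bigr => j _; rewrite sum1_card; apply: eq_card => -[g s].
rewrite !inE /= unfold_in /= !inE /=.
case: (_ == _) / eqP => [imp_g|]; last by rewrite andbF.
rewrite -val_eqE /= inordK // ltnS -imp_g; apply: subset_leq_card.
exact: children_improper.
Qed.

Lemma card_slice0 n k : 0 < n -> #|slice n 0 k| = n * #|rooted_maps n k|.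
Proof.
move=> n0; rewrite mulnC -[X in _ = _ * X]card_ord -cardsT -cardsX.
rewrite -(card_imset _ (@add_leaf_inj n)); apply: eq_card => -[g s].
have leafE f r v : (add_leaf (f, r, v) \in rooted_maps n.+1 k) =
    ((f, r) \in rooted_maps n k).
  rewrite !inE add_leaf_parent_map add_leaf_improper.
  by rewrite (card_imset _ (@lift_inj _ _)).
apply/setIdP/imsetP => [[gk]|[[[f r] v]]].
  rewrite cards_eq0 => /eqP c0; have pg : parent_map g s.
    by move: gk; rewrite inE => /andP[].
  have [[[f r] v] E] := add_leaf_surj n0 pg c0; exists (f, r, v) => //.
  by rewrite in_setX in_setT andbT -(leafE f r v) E.
rewrite in_setX in_setT andbT => frk E; rewrite E leafE; split=> //.
by rewrite add_leaf_children cards0.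
Qed.

Lemma card_slice1 n k : #|slice n 1 k.+1| = n * #|rooted_maps n k|.
Proof.
rewrite mulnC -[X in _ = _ * X]card_ord -cardsT -cardsX.
rewrite -(card_imset _ (@add_above_inj n)); apply: eq_card => -[g s].
have aboveE f r v : (add_above (f, r, v) \in rooted_maps n.+1 k.+1) =
    ((f, r) \in rooted_maps n k).
  by rewrite !inE add_above_parent_map card_add_above_improper.
apply/setIdP/imsetP => [[gk c1]|[[[f r] v]]].
  have pg : parent_map g s by move: gk; rewrite inE => /andP[].
  have [[[f r] v] E] := add_above_surj pg (eqP c1); exists (f, r, v) => //.
  by rewrite in_setX in_setT andbT -(aboveE f r v) E.
rewrite in_setX in_setT andbT => frk E; rewrite E aboveE; split=> //.
by rewrite add_above_children cards1.
Qed.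

(** The star whose root is the largest label. *)
Lemma slice_star n : 0 < #|slice n n n|.
Proof.
pose g : {ffun 'I_n.+1 -> 'I_n.+1} := [ffun=> ord_max].
have gE x : g x = ord_max by rewrite ffunE.
have cE : children_max g = [set~ ord_max].
  by apply/setP => x; rewrite !inE gE eqxx.
have iE : improper g = children_max g.
  apply/eqP; rewrite eqEsubset children_improper andbT.
  by apply/subsetP => x; rewrite !inE gE eqxx eq_sym => /andP[].
apply/card_gt0P; exists (g, ord_max).
rewrite !inE /= iE cE cardsC1 card_ord eqxx !andbT /parent_map gE eqxx /=.
by apply/forallP => x; rewrite -(gE x) fconnect1.
Qed.

Lemma rooted_maps1 k : #|rooted_maps 1 k| = (k == 0).
Proof.
have arb (T : {ffun 'I_1 -> 'I_1} * 'I_1) : (T \in rooted_maps 1 k) = (k == 0).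
  rewrite !inE; have -> : improper T.1 = set0.
    by apply/setP => x; rewrite !inE !ord1.
  rewrite cards0 [_ == k]eq_sym /parent_map (ord1 (T.1 T.2)) (ord1 T.2) eqxx /=.
  by rewrite (_ : [forall v, _]) //; apply/forallP => x; rewrite (ord1 x) connect0.
have -> : rooted_maps 1 k = [set T | k == 0].
  by apply/setP => T; rewrite arb inE.
case: (k == 0); last by apply: eq_card0 => T; rewrite inE.
rewrite -[RHS](_ : #|{: {ffun 'I_1 -> 'I_1} * 'I_1}| = 1).
  by apply: eq_card => T; rewrite !inE.
by rewrite card_prod card_ffun !card_ord.
Qed.

(** The trees in which the largest label has [0] or [1] children give a
    recurrence for the first two counts.  In the third one there are also trees
    in which it has [2] children; of these, only the star on three vertices is
    taken into account. *)
Lemma card_rooted_maps n :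
  [/\ #|rooted_maps n.+1 0| = n`!,
      #|rooted_maps n.+1 1| = n * n`! &
      'C(n, 2) * n`! + (1 < n) <= #|rooted_maps n.+1 2|].
Proof.
elim: n => [|n [IH0 IH1 IH2]]; first by rewrite !rooted_maps1.
(* The strictness of the third bound starts here, at the step to [n.+2 = 3]. *)
have s3 : (n == 1) <= #|slice n.+1 2 2|.
  by case: eqP => // ->; apply: slice_star.
rewrite !card_slices !big_ord_recr !big_ord0 /= !card_slice0 // !card_slice1.
rewrite IH0 IH1; split; rewrite ?factS //; first by ring.
rewrite binS bin1 !add0n.
apply: (@leq_trans (n.+1 * ('C(n, 2) * n`! + (1 < n))
                     + n.+1 * (n * n`!) + (n == 1))).
  have -> : ('C(n, 2) + n) * (n.+1 * n`!) =
      n.+1 * ('C(n, 2) * n`!) + n.+1 * (n * n`!) by ring.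
  rewrite mulnDr [X in _ <= X + _]addnAC -[X in _ <= X]addnA leq_add2l ltnS.
  by case: n {IH0 IH1 IH2 s3} => [|[|n]] //; rewrite muln1.
by rewrite leq_add // leq_add2r leq_mul2l IH2 orbT.
Qed.

(** * Nonreal roots *)

Section NonrealRoots.

Import GRing.Theory Num.Theory Order.TTheory.
Local Open Scope ring_scope.

(** These are the first two power sums of the inverses of the roots, in terms
    of the lowest coefficients. *)
Lemma coef_prod_roots (F : fieldType) (s : seq F) :
    0 \notin s -> let q := \prod_(z <- s) ('X - z%:P) in
  q`_1 = - (q`_0 * \sum_(z <- s) z^-1) /\
  q`_1 ^+ 2 - (q`_0 * q`_2) *+ 2 = q`_0 ^+ 2 * \sum_(z <- s) z^-1 ^+ 2.
Proof.
elim: s => [|z s IH] /=.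
  by rewrite !big_nil !coef1 /= !mulr0 oppr0 expr0n mul0rn subr0.
rewrite inE negb_or eq_sym !big_cons => /andP[z0 /IH[]].
set q := \prod_(_ <- _) _; set S := \sum_(_ <- _) _; set Q := \sum_(_ <- _) _.
move=> q1 q2; rewrite !mulrBl !coefB !coefCM !coefXM /=.
split; first by rewrite q1; field.
transitivity (q`_0 ^+ 2 + z ^+ 2 * (q`_1 ^+ 2 - q`_0 * q`_2 *+ 2)); first by ring.
by rewrite q2; field.
Qed.

(** If all roots were real, [\sum (z^-1 + 1)^2] would be nonnegative, whereas
    the hypotheses make it negative; see the argument at the top. *)
Lemma nonreal_root (C : numClosedFieldType) (p : {poly C}) (d : nat) :
    (size p <= d.+1)%N -> p`_0 != 0 -> p`_1 = d%:R * p`_0 ->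
    (d * d.-1)%:R < p`_2 / p`_0 *+ 2 ->
  exists2 z, root p z & z \isn't Num.real.
Proof.
move=> size_p p0 p1 p2; have [s ps] := closed_field_poly_normal p.
have c0 : lead_coef p != 0.
  by apply: contraNneq p0 => c0; rewrite ps c0 scale0r coef0.
have rootE z : root p z = (z \in s) by rewrite ps rootZ // root_prod_XsubC.
have size_s : (size s <= d)%N.
  by rewrite -ltnS -(size_prod_XsubC s id) -(size_scale _ c0) -ps.
have s0 : 0 \notin s by rewrite -rootE /root horner_coef0.
case: (boolP (all (mem Num.real) s)) => [/allP s_real|/allPn[z zs zr]]; last first.
  by exists z; rewrite ?rootE.
have [] := coef_prod_roots s0; set q := \prod_(_ <- _) _.
set S := \sum_(_ <- _) _; set Q := \sum_(_ <- _) _ => q1 q2.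
have pE i : p`_i = lead_coef p * q`_i by rewrite {1}ps -/q coefZ.
have q0 : q`_0 != 0 by apply: contraNneq p0; rewrite pE => ->; rewrite mulr0.
have q1E : q`_1 = d%:R * q`_0.
  by apply: (mulfI c0); rewrite -pE p1 pE mulrCA.
have SE : S = - d%:R.
  by apply: (mulfI q0); rewrite mulrN -[LHS]opprK -q1 q1E mulrC.
have QE : Q = d%:R ^+ 2 - p`_2 / p`_0 *+ 2.
  apply: (mulfI (expf_neq0 2 q0)); rewrite -q2 q1E !pE; field.
  by rewrite q0 c0.
have sum_ge0 : 0 <= \sum_(z <- s) (z^-1 + 1) ^+ 2.
  rewrite big_seq; apply: sumr_ge0 => z zs.
  by rewrite real_exprn_even_ge0 // realD ?real1 // realV; apply: s_real.
have sumE : \sum_(z <- s) (z^-1 + 1) ^+ 2 = Q + S *+ 2 + (size s)%:R.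
  rewrite /Q /S -sumrMnl -sum1_size natr_sum -!big_split /=.
  by apply: eq_bigr => z _; ring.
have Qd : d%:R <= Q.
  rewrite -subr_ge0; apply: le_trans sum_ge0 _; rewrite sumE SE.
  have -> : Q - d%:R = Q + (- d%:R) *+ 2 + d%:R by ring.
  by rewrite lerD2l ler_nat.
suff : Q < d%:R by move/(le_lt_trans Qd); rewrite ltxx.
rewrite QE ltrBlDr -ltrBlDl; apply: le_lt_trans p2.
case: (d) => [|k]; first by rewrite expr0n subrr.
rewrite natrM -natr1 /=.
by have -> : (k%:R + 1) ^+ 2 - (k%:R + 1) = (k%:R + 1) * k%:R :> C by ring.
Qed.

Lemma R_poly_nonreal_root (R : realType) (n : nat) : (2 < n)%N ->
  exists2 z : complex R,
    root (map_poly (real_complex R) (R_poly R n)) z & z \isn't Num.real.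
Proof.
case: n => [|d] // hd; have [r0 r1 r2] := card_rooted_maps d.
have pE k : (k <= d)%N ->
    (map_poly (real_complex R) (R_poly R d.+1))`_k = #|rooted_maps d.+1 k|%:R.
  by move=> kd; rewrite coef_map /= coef_poly ltnS kd rmorph_nat nb_treesE.
have d1 : (1 < d)%N := hd; have d0 := ltnW d1.
have fact_neq0 : (d`!)%:R != 0 :> complex R by rewrite pnatr_eq0 -lt0n fact_gt0.
apply: (@nonreal_root _ _ d); rewrite ?pE // ?r0 ?r1 -?natrM //.
  by rewrite size_map_poly size_poly.
have -> : (d * d.-1 = 'C(d, 2) * 2)%N.
  by rewrite (bin_ffact d 2) !ffactnS ffactn0 muln1.
rewrite natrM -[X in _ < X]mulr_natr ltr_pM2r ?ltr0n //.
rewrite ltr_pdivlMr ?ltr0n ?fact_gt0 //.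
rewrite -natrM ltr_nat; apply: leq_trans r2.
by rewrite [X in (_ < _ + X)%N](_ : _ = 1%N) ?addn1 // d1.
Qed.

End NonrealRoots.

Theorem proposition2p1 (R : realType) (n : nat) (hn : 3 <= n) :
  ~ real_rooted (R_poly R n) /\
  exists z : complex R,
    root (map_poly (real_complex R) (R_poly R n)) z /\ complex.Im z <> 0%R.
Proof.
have [z rz z_nonreal] := R_poly_nonreal_root R hn.
have Iz : complex.Im z <> 0%R.
  by case: z z_nonreal {rz} => a b; rewrite complex_real => /eqP.
by split; [move/(_ z rz) | exists z].
Qed.
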